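(* Let $M$ be a positive integer and let $d_1,\dots,d_{2M-1}$ be any integers with $1\le d_n<M-1$ for all $n$. Then there exist subspaces $W_1,\dots,W_{2M-1}$ of $\mathbb{R}^M$ with $\dim W_n=d_n$ for every $n=1,\dots,2M-1$ such that $\{W_n\}_{n=1}^{2M-1}$ allows phase retrieval in $\mathbb{R}^M$.
   Context: Given subspaces $\{W_n\}_{n=1}^N$ of $\mathbb{R}^M$ with orthogonal projections $P_n:\mathbb{R}^M\to W_n$, one says that $\{W_n\}_{n=1}^N$ allows phase retrieval in (or for) $\mathbb{R}^M$ if the map $\mathcal{A}:\mathbb{R}^M/\{\pm1\}\to\mathbb{R}^N$, $\mathcal{A}(x)(n)=\|P_nx\|^2$, is injective; that is, whenever $x,y\in\mathbb{R}^M$ satisfy $\|P_nx\|=\|P_ny\|$ for all $n$, then $x=y$ or $x=-y$. *)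

(* Defs.v *)
From HB Require Import structures.
From mathcomp Require Import all_boot all_order all_algebra.
From mathcomp Require Import reals.

Set Implicit Arguments.
Unset Strict Implicit.
Unset Printing Implicit Defensive.

Import Order.TTheory GRing.Theory Num.Theory.
Local Open Scope ring_scope.

Section EuclideanSpace.

Variables (R : realType) (M : nat).
Implicit Types (x y z : 'rV[R]_M) (W : {vspace 'rV[R]_M}).

Definition dotv x y : R := \sum_(i < M) x 0 i * y 0 i.

Definition enorm x : R := Num.sqrt (dotv x x).

Fact dotv_is_linear x : linear (dotv x : 'rV[R]_M -> R^o).
Proof.
move=> a y z; rewrite /dotv scaler_sumr -big_split /=.
by apply: eq_bigr => i _; rewrite !mxE mulrDr mulrCA.
Qed.

HB.instance Definition _ x :=
  GRing.isLinear.Build R 'rV[R]_M R^o _ (dotv x) (dotv_is_linear x).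

Definition orthov W : {vspace 'rV[R]_M} :=
  (\bigcap_(w <- vbasis W) lker (linfun (dotv w : 'rV[R]_M -> R^o)))%VS.

(* Projection onto W along its orthogonal complement; [addv_orthov] and
   [capv_orthov] show that the two are supplementary. *)
Definition orthproj W : 'End('rV[R]_M) := daddv_pi W (orthov W).

Lemma dotvC x y : dotv x y = dotv y x.
Proof. by apply: eq_bigr => i _; rewrite mulrC. Qed.

Lemma dotvv_eq0 x : (dotv x x == 0) = (x == 0).
Proof.
apply/eqP/eqP => [x0|->]; last by rewrite [LHS]linear0.
apply/rowP => i; rewrite mxE; apply/eqP; rewrite -sqrf_eq0 expr2; apply/eqP.
by apply: (psumr_eq0P _ x0) => // j _; rewrite -expr2 sqr_ge0.
Qed.

Lemma orthovP W x :
  reflect (forall w, w \in W -> dotv w x = 0) (x \in orthov W).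
Proof.
have -> : (x \in orthov W) = all (fun w => dotv w x == 0) (vbasis W).
  rewrite /orthov; elim: (tval (vbasis W)) => [|w s IHs] /=.
    by rewrite big_nil memvf.
  by rewrite big_cons memv_cap IHs memv_ker lfunE.
apply: (iffP allP) => [x0 w /coord_vbasis -> | x0 w /vbasis_mem /x0 -> //].
rewrite dotvC linear_sum big1 // => i _; rewrite linearZ /= dotvC.
by rewrite (eqP (x0 _ _)) ?scaler0 // mem_nth // size_tuple.
Qed.

Lemma capv_orthov W : (W :&: orthov W = 0)%VS.
Proof.
apply/eqP; rewrite -subv0; apply/subvP => x; rewrite memv_cap.
by case/andP=> Wx /orthovP /(_ x Wx) /eqP; rewrite dotvv_eq0 memv0.
Qed.

Lemma addv_orthov W : (W + orthov W = fullv)%VS.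
Proof.
pose g x : 'rV[R]_(\dim W) := \row_i dotv (vbasis W)`_i x.
have lin_g : linear g.
  by move=> a x y; apply/rowP => i; rewrite !mxE linearP.
pose gL : {linear 'rV[R]_M -> 'rV[R]_(\dim W)} :=
  HB.pack g (GRing.isLinear.Build R _ _ _ g lin_g).
have ker_g : (lker (linfun gL) <= orthov W)%VS.
  apply/subvP => x; rewrite memv_ker lfunE /= => /eqP gx0.
  apply/orthovP => w /coord_vbasis ->.
  rewrite dotvC linear_sum big1 // => i _; rewrite linearZ /= dotvC.
  by move/rowP/(_ i): gx0; rewrite !mxE => ->; rewrite scaler0.
apply/eqP; rewrite eqEdim subvf dimv_disjoint_sum ?capv_orthov //.
rewrite -(limg_ker_dim (linfun gL) fullv) capfv addnC.
rewrite leq_add ?dimvS //.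
by rewrite (leq_trans (dimvS (subvf _))) // dimvf /dim /= mul1n.
Qed.

Lemma orthproj_mem W x : orthproj W x \in W.
Proof. exact: memv_pi. Qed.

Lemma orthproj_orth W x w : w \in W -> dotv w (x - orthproj W x) = 0.
Proof.
move=> Ww; suff /orthovP-> : x - orthproj W x \in orthov W by [].
rewrite -{1}(daddv_pi_add (w := x) (capv_orthov W)) ?addv_orthov ?memvf //.
by rewrite addrC addKr memv_pi.
Qed.

Definition phase_retrieval (N : nat) (W : 'I_N -> {vspace 'rV[R]_M}) : Prop :=
  forall x y : 'rV[R]_M,
    (forall n, enorm (orthproj (W n) x) = enorm (orthproj (W n) y)) ->
    x = y \/ x = - y.

End EuclideanSpace.

(* Main.v *)
Require Import Defs.
From mathcomp Require Import all_boot all_order all_fingroup all_algebra.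
From mathcomp Require Import ring zify reals.

Set Implicit Arguments.
Unset Strict Implicit.
Unset Printing Implicit Defensive.

Import Order.TTheory GRing.Theory Num.Theory.
Local Open Scope ring_scope.

(** Writing u = x + y and v = x - y, the equality |P x| = |P y| of the norms of
    two projections says <P u, v> = 0.  If P projects onto the span of some
    members of a basis v_0, ..., v_(M-1) of pairwise orthogonal vectors of equal
    norm, indexed by a set S, this reads: the products
    h_j = <v_j, u> <v_j, v> add up to 0 over j in S.

    The 2M-1 subspaces come from two such bases.  M of them are coordinate
    subspaces.  Their index sets have prescribed sizes strictly between 0 and M,
    and can be chosen so that their indicator vectors are linearly independent
    ([separating_sets]); then every h_i = u_i v_i vanishes.  In particular u and
    v are orthogonal, so for the second basis the sum of all the h_j is known to
    be 0 beforehand, and M-1 further subspaces suffice to make every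
    <v_j, u> <v_j, v> vanish too.

    So u and v have disjoint supports in both bases.  Either u or v must then be
    zero as soon as the bases satisfy the uncertainty principle that a nonzero
    vector has more than M nonzero coordinates in all ([uncertainty],
    [disjoint_supp_eq0]).  This holds when all the minors of the change of basis
    V are nonzero, and what remains is a multiple V of a real orthogonal matrix
    with that property ([exists_generic_orthogonal]).  Such a V exists because
    the rotations are connected by rational curves: along a polynomial curve a
    minor that is nonzero at one point vanishes only at finitely many points, so
    it is enough to make each minor nonzero separately, which signed permutation
    matrices do. *)

(** * Finite sets and polynomials *)

Lemma exists_subset_card (T : finType) (A : {set T}) k : (k <= #|A|)%N ->
  exists2 B : {set T}, B \subset A & #|B| = k.
Proof.
case/card_geqP => s [/card_uniqP s_uniq sz_s /subsetP sA].
exists [set x in s]; last by rewrite cardsE s_uniq.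
by apply/subsetP => x; rewrite inE => /(subsetP sA).
Qed.

(** Both orderings list every element of T, those of A, resp. of B, coming
    first; the permutation matches the two lists. *)
Lemma exists_perm_into (T : finType) (A B : {set T}) : (#|A| <= #|B|)%N ->
  exists s : {perm T}, {in A, forall x, s x \in B}.
Proof.
move=> leAB; pose order (C : {set T}) := enum C ++ enum (~: C).
have uniq_order C : uniq (order C).
  rewrite cat_uniq !enum_uniq andbT /=; apply/hasPn => x.
  by rewrite !mem_enum inE.
have mem_order C x : x \in order C by rewrite mem_cat !mem_enum inE orbN.
have size_order C : size (order C) = #|T| by rewrite size_cat -!cardE cardsC.
pose f x := nth x (order B) (index x (order A)).
have index_lt x : (index x (order A) < size (order B))%N.
  by rewrite size_order -(size_order A) index_mem mem_order.
have f_inj : injective f.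
  move=> x y /eqP; rewrite /f (set_nth_default y) // nth_uniq //.
  by move/eqP; apply: (index_inj x); exact: mem_order.
exists (perm f_inj) => x Ax; rewrite permE /f nth_cat index_cat mem_enum Ax.
have lt_xB : (index x (enum A) < size (enum B))%N.
  by rewrite -cardE (leq_trans _ leAB) // cardE index_mem mem_enum.
by rewrite lt_xB -mem_enum mem_nth.
Qed.

Lemma exists_nonroot (F : numFieldType) (p : {poly F}) :
  p != 0 -> exists t, p.[t] != 0.
Proof.
move=> p0; pose ts := [seq i%:R : F | i <- iota 0 (size p)].
have [|/allPn[t _ pt]] := boolP (all (root p) ts); last by exists t.
move=> /(max_poly_roots p0); rewrite size_map size_iota ltnn => tsP.
suff /tsP : uniq ts by [].
by rewrite map_inj_uniq ?iota_uniq // => i j /eqP; rewrite eqr_nat => /eqP.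
Qed.

(** * Minors as determinants of a fixed size *)

(** Up to sign, the determinant of this matrix is the minor of A on the rows
    s(I) and the columns I.  Keeping the size n turns all the minors into
    polynomial functions of A indexed by one finite type. *)
Definition mixmx (S : nzRingType) n (s : 'S_n) (I : {set 'I_n}) (A : 'M[S]_n) :=
  \matrix_(i, j) (if i \in I then A (s i) j else (i == j)%:R).

Lemma map_mixmx (S T : nzRingType) (f : {rmorphism S -> T}) n s I
    (A : 'M[S]_n) :
  map_mx f (mixmx s I A) = mixmx s I (map_mx f A).
Proof.
by apply/matrixP => i j; rewrite !mxE; case: ifP; rewrite // rmorph_nat.
Qed.

(** * Polynomial curves of multiples of orthogonal matrices *)

(** Over the reals, such an A acts as a quarter turn on its image and as 0 on the
    orthogonal complement.  G is 1 + t^2 times the rotation of that image by the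
    angle 2 arctan t: the rational parametrization of rotations, freed from its
    denominators. *)
Lemma rotation_orth (S : comNzRingType) n (A : 'M[S]_n) (t : S) :
  A^T = - A -> A *m A *m A = - A ->
  let G := (1 + t ^+ 2)%:M + (t *+ 2) *: A + (t ^+ 2 *+ 2) *: (A *m A) in
  G *m G^T = ((1 + t ^+ 2) ^+ 2)%:M.
Proof.
move=> AT A3 G.
have -> : G^T = (1 + t ^+ 2)%:M - (t *+ 2) *: A + (t ^+ 2 *+ 2) *: (A *m A).
  rewrite !linearD !linearZ /= tr_scalar_mx trmx_mul AT.
  by rewrite mulNmx mulmxN opprK scalerN.
have A3' : A *m (A *m A) = - A by rewrite mulmxA.
have A4 : A *m A *m (A *m A) = - (A *m A) by rewrite mulmxA A3 mulNmx.
rewrite /G; have [B AA] : exists B, A *m A = B by exists (A *m A).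
rewrite AA in A3 A3' A4 *.
rewrite !(mulmxDl, mulmxDr, mulNmx, mulmxN) -!scalemxAl -!scalemxAr.
rewrite !mul_mx_scalar !mul_scalar_mx A3 A3' A4 AA.
by apply/matrixP => i j; rewrite !mxE; case: (i == j); ring.
Qed.

Section Paths.

Variables (F : numFieldType) (n : nat).
Implicit Types (P Q : 'M[{poly F}]_n) (s : 'S_n) (I : {set 'I_n}).

Definition evmx (t : F) P : 'M[F]_n := map_mx (horner_eval t) P.

(** The condition at 0 makes endpoints connectable: from two such curves R
    and Q one gets the curve R(1 - t) Q(t) from R(1) to Q(1). *)
Definition orthopath P := (exists q, P *m P^T = q%:M) /\ evmx 0 P = 1%:M.

Lemma evmxM t P Q : evmx t (P *m Q) = evmx t P *m evmx t Q.
Proof. exact: map_mxM. Qed.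

Lemma evmx1 t : evmx t 1%:M = 1%:M.
Proof. exact: map_mx1. Qed.

Lemma evmx_comp t r P : evmx t (map_mx (comp_poly r) P) = evmx r.[t] P.
Proof. by apply/matrixP => i j; rewrite !mxE /= /horner_eval horner_comp. Qed.

Lemma orthopath1 : orthopath 1%:M.
Proof. by split; [exists 1; rewrite trmx1 mulmx1 | exact: evmx1]. Qed.

Lemma orthopathM P Q : orthopath P -> orthopath Q -> orthopath (P *m Q).
Proof.
case=> -[p Pp] P0 [[q Qq] Q0]; split; last by rewrite evmxM P0 Q0 mulmx1.
exists (q * p).
rewrite trmx_mul mulmxA -(mulmxA P) Qq.
by rewrite mul_mx_scalar -scalemxAl Pp scale_scalar_mx.
Qed.

Lemma orthopath_comp r P : r.[0] = 0 -> orthopath P ->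
  orthopath (map_mx (comp_poly r) P).
Proof.
move=> r0 [[q Pq] P0]; split; last by rewrite evmx_comp r0.
exists (q \Po r).
by rewrite map_trmx -map_mxM Pq map_scalar_mx.
Qed.

Lemma det_mixmx_evmx t s I P :
  \det (mixmx s I (evmx t P)) = (\det (mixmx s I P)).[t].
Proof. by rewrite -map_mixmx det_map_mx. Qed.

(** Conditions that can be met one at a time can be met together.  If the
    endpoint of R meets those of cs and the endpoint of Q meets c, then on the
    curve R(1 - t) Q(t) each determinant is a nonzero polynomial in t,
    so some t is a root of none of them; the point reached there is again the
    endpoint of a curve from the identity. *)
Lemma generic_endpoint (cs : seq ('S_n * {set 'I_n})) :
  {in cs, forall c, exists2 Q, orthopath Q &
     \det (mixmx c.1 c.2 (evmx 1 Q)) != 0} ->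
  exists2 P, orthopath P &
    {in cs, forall c, \det (mixmx c.1 c.2 (evmx 1 P)) != 0}.
Proof.
elim: cs => [_|c cs IHcs csP]; first by exists 1%:M; [exact: orthopath1|].
have [c' csc'|R oR Rcs] := IHcs; first by apply: csP; rewrite inE csc' orbT.
have [Q oQ Qc] := csP c (mem_head _ _).
pose S := map_mx (comp_poly (1 - 'X)) R *m Q.
have S0 : evmx 0 S = evmx 1 R.
  by rewrite evmxM evmx_comp !hornerE subr0 oQ.2 mulmx1.
have S1 : evmx 1 S = evmx 1 Q.
  by rewrite evmxM evmx_comp !hornerE subrr oR.2 mul1mx.
pose g (c : 'S_n * {set 'I_n}) := \det (mixmx c.1 c.2 S).
have : \prod_(c' <- c :: cs) g c' != 0.
  rewrite prodf_seq_neq0; apply/allP => c'; rewrite inE /= => /orP[/eqP->|csc'].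
    apply: contraNneq Qc.
    by rewrite -S1 det_mixmx_evmx -/(g _) => ->; rewrite horner0.
  apply: contraNneq (Rcs _ csc').
  by rewrite -S0 det_mixmx_evmx -/(g _) => ->; rewrite horner0.
case/exists_nonroot => t; rewrite horner_prod prodf_seq_neq0 => /allP gt.
exists (map_mx (comp_poly ((1 - t) *: 'X)) R *m map_mx (comp_poly (t *: 'X)) Q).
  by apply: orthopathM; apply: orthopath_comp => //; rewrite !hornerE ?mulr0.
move=> c' /gt /=; rewrite /g -det_mixmx_evmx /S !evmxM !evmx_comp.
by rewrite !hornerE.
Qed.

(** Turning the plane of the a-th and b-th axes up to a quarter turn exchanges
    the two axes, up to a sign. *)
Lemma orthopath_tperm (a b : 'I_n) : exists2 G, orthopath G &
  forall i, exists2 c : F, c != 0 &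
    forall j, evmx 1 G i j = c * (tperm a b i == j)%:R.
Proof.
have [<-|neq_ab] := eqVneq a b.
  exists 1%:M; first exact: orthopath1.
  move=> i; exists 1; rewrite ?oner_eq0 // => j.
  by rewrite evmx1 tperm1 perm1 mxE mul1r.
have neq_ba : b != a by rewrite eq_sym.
pose A : 'M[{poly F}]_n := delta_mx a b - delta_mx b a.
have A2 : A *m A = - (delta_mx a a + delta_mx b b).
  rewrite mulmxBl !mulmxBr !mul_delta_mx !mul_delta_mx_0 //.
  by rewrite sub0r subr0 opprD.
have A3 : A *m A *m A = - A.
  rewrite A2 mulNmx mulmxDl !mulmxBr !mul_delta_mx !mul_delta_mx_0 //.
  by rewrite subr0 sub0r.
have AT : A^T = - A.
  by rewrite /A linearB /= !trmx_delta opprB.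
exists ((1 + 'X^2)%:M + ('X *+ 2) *: A + ('X^2 *+ 2) *: (A *m A)).
  split; last first.
    rewrite /evmx !map_mxD !map_mxZ map_scalar_mx /= /horner_eval !hornerE.
    by rewrite expr0n /= !addr0 !scale0r !addr0.
  by exists ((1 + 'X^2) ^+ 2); exact: rotation_orth.
move=> i.
(* At t = 1 the matrix is twice a rotation by a right angle, whose two
   nontrivial entries are 1 in row a and -1 in row b. *)
exists (if i == b then - 2%:R else 2%:R) => [|j].
  by case: ifP; rewrite ?oppr_eq0 pnatr_eq0.
rewrite A2 !mxE /horner_eval /=.
have natE (e : bool) : (e%:R : {poly F}).[1] = e%:R by case: e; rewrite hornerE.
rewrite !(hornerE, natE, hornerMn) expr1n.
case: tpermP => [-> | -> | /eqP/negPf ia /eqP/negPf ib].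
- rewrite eqxx (negPf neq_ab) /= !(eq_sym _ j).
  have [->|_] := eqVneq j a; rewrite ?(negPf neq_ab) /=; first by ring.
  by case: (j == b) => /=; ring.
- rewrite eqxx (negPf neq_ba) /= !(eq_sym _ j).
  have [->|_] := eqVneq j a; rewrite ?(negPf neq_ab) /=; first by ring.
  by case: (j == b) => /=; ring.
by rewrite ia ib; case: (i == j) => /=; ring.
Qed.

End Paths.

Lemma orthopath_perm (F : numFieldType) n (s : 'S_n) :
  exists2 Q : 'M[{poly F}]_n, orthopath Q &
    forall i, exists2 c : F, c != 0 &
      forall j, evmx 1 Q (s i) j = c * (i == j)%:R.
Proof.
have [ts -> _] := prod_tpermP s; elim: ts => [|[a b] ts [Q oQ Qs]].
  exists 1%:M; first exact: orthopath1.
  move=> i; exists 1 => [|j]; first exact: oner_neq0.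
  by rewrite big_nil perm1 evmx1 mxE mul1r.
have [G oG Gab] := orthopath_tperm F a b.
exists (Q *m G); first exact: orthopathM.
move=> i; have [c c0 Qc] := Qs (tperm a b i).
have [c' c'0 Gc] := Gab (tperm a b i).
exists (c * c') => [|j]; first exact: mulf_neq0.
rewrite big_cons permM /= evmxM mxE (bigD1 (tperm a b i)) //= [X in _ + X]big1.
  by rewrite Qc eqxx mulr1 Gc tpermK addr0 mulrA.
by move=> k /negPf ki; rewrite Qc eq_sym ki mulr0 mul0r.
Qed.

(** For n > 0 the case s = 1 and I = setT makes V invertible, so q is nonzero and
    V is a multiple of an orthogonal matrix, up to a square root of q. *)
Lemma exists_generic_orthogonal (F : numFieldType) n :
  exists2 V : 'M[F]_n, (exists q, V *m V^T = q%:M) &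
    forall s I, \det (mixmx s I V) != 0.
Proof.
have [|P [[q Pq] _] Pgen] :=
    @generic_endpoint F n (enum ({: 'S_n * {set 'I_n}})).
  move=> [s I] _ /=; have [Q oQ Qs] := orthopath_perm F s.
  exists Q => //.
  (* Row s i of Q(1) is proportional to the i-th basis vector. *)
  have -> : mixmx s I (evmx 1 Q) =
            diag_mx (\row_i (if i \in I then evmx 1 Q (s i) i else 1)).
    move: (evmx 1 Q) Qs => Q1 Qs; apply/matrixP => i j.
    rewrite !mxE; have [c _ Qc] := Qs i.
    by rewrite !Qc eqxx mulr1; case: ifP => _; rewrite ?mulr_natr.
  rewrite det_diag; apply/prodf_neq0 => i _; rewrite mxE.
  case: ifP => _; last exact: oner_neq0.
  by have [c c0 ->] := Qs i; rewrite eqxx mulr1.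
exists (evmx 1 P); last by move=> s I; apply: (Pgen (s, I)); rewrite mem_enum.
by exists q.[1]; rewrite /evmx map_trmx -map_mxM Pq map_scalar_mx.
Qed.

(** * The uncertainty principle *)

Definition supp (F : nzRingType) n (u : 'cV[F]_n) := [set i | u i 0 != 0].

(** If the supports were too small, some permutation s would send the support of
    u into the set of zeros of V u; all the equations (V u)_(s i) = 0 for i in
    the support of u and u_i = 0 elsewhere then say that an invertible matrix
    kills u. *)
Lemma uncertainty (F : fieldType) n (V : 'M[F]_n) (u : 'cV[F]_n) :
  (forall s I, \det (mixmx s I V) != 0) -> u != 0 ->
  (n < #|supp u| + #|supp (V *m u)|)%N.
Proof.
move=> Vgen; apply: contraNltn => le_n.
have [|s sP] := @exists_perm_into _ (supp u) (~: supp (V *m u)).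
  by rewrite [leqRHS]cardsCs setCK card_ord; lia.
have mix_unit : mixmx s (supp u) V \in unitmx by rewrite unitmxE unitfE.
suff mixu0 : mixmx s (supp u) V *m u = 0.
  by rewrite -(mulKmx mix_unit u) mixu0 mulmx0.
apply/colP => i; rewrite !mxE; have [ui|ui] := boolP (i \in supp u).
  move/sP: (ui); rewrite !inE negbK mxE => /eqP {2}<-.
  by apply: eq_bigr => k _; rewrite mxE ui.
rewrite big1 // => k _; rewrite mxE (negPf ui).
case: eqVneq => [<-|_]; rewrite ?mul0r ?mul1r //.
by move: ui; rewrite inE negbK => /eqP.
Qed.

(** Two nonzero vectors would have more than 2n nonzero coordinates in the two
    bases, whereas disjointness allows at most n in each. *)
Lemma disjoint_supp_eq0 (F : fieldType) n (V : 'M[F]_n) (u v : 'cV[F]_n) :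
  (forall s I, \det (mixmx s I V) != 0) ->
  (forall i, u i 0 * v i 0 = 0) ->
  (forall j, (V *m u) j 0 * (V *m v) j 0 = 0) -> u = 0 \/ v = 0.
Proof.
move=> Vgen.
have card_supp (w z : 'cV[F]_n) : (forall i, w i 0 * z i 0 = 0) ->
    (#|supp w| + #|supp z| <= n)%N.
  move=> wz; rewrite -cardsUI -[leqRHS]card_ord.
  rewrite (_ : supp w :&: supp z = set0) ?cards0 ?addn0 ?max_card //.
  by apply/setP => i; rewrite !inE -negb_or -mulf_eq0 wz eqxx.
move=> /card_supp le_uv /card_supp le_Vuv.
have [->|/(uncertainty Vgen) lt_u] := eqVneq u 0; first by left.
have [->|/(uncertainty Vgen) lt_v] := eqVneq v 0; first by right.
have := leq_add lt_u lt_v; have := leq_add le_uv le_Vuv.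
by lia.
Qed.

(** * Index sets of prescribed sizes with independent indicators *)

Section SeparatingSets.

Variables (F : numFieldType) (n : nat).

(** If all the sums over k-element sets vanished, exchanging i for j in such
    a set would show that h is constant, hence 0. *)
Lemma exists_sum_neq0 (h : 'rV[F]_n) k : h != 0 -> (0 < k < n)%N ->
  exists2 S : {set 'I_n}, #|S| = k & \sum_(i in S) h 0 i != 0.
Proof.
move=> h0 /andP[k_gt0 lt_kn].
have [/existsP[S /andP[/eqP Sk hS]]|] :=
    boolP [exists S : {set 'I_n}, (#|S| == k) && (\sum_(i in S) h 0 i != 0)].
  by exists S.
rewrite negb_exists => /forallP sum0.
have {}sum0 (S : {set 'I_n}) : #|S| = k -> \sum_(i in S) h 0 i = 0.
  by move=> Sk; have := sum0 S; rewrite Sk eqxx negbK => /eqP.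
have h_const i j : h 0 i = h 0 j.
  have [->//|neq_ij] := eqVneq i j.
  have [B /subsetP sB Bk] :
      exists2 B : {set 'I_n}, B \subset ~: [set i; j] & #|B| = k.-1.
    apply: exists_subset_card.
    by rewrite cardsCs setCK cards2 neq_ij card_ord; lia.
  have [iB jB] : i \notin B /\ j \notin B.
    by split; apply/negP => /sB; rewrite !inE eqxx ?orbT.
  apply: (@addIr _ (\sum_(l in B) h 0 l)).
  by rewrite -!big_setU1 // !sum0 // cardsU1 ?iB ?jB Bk add1n prednK.
have [S _ Sk] : exists2 S : {set 'I_n}, S \subset [set: 'I_n] & #|S| = k.
  by apply: exists_subset_card; rewrite cardsT card_ord ltnW.
case/eqP: h0; apply/rowP => i; rewrite mxE; apply/eqP.
have /eqP := sum0 S Sk; rewrite (eq_bigr (fun=> h 0 i)) //.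
by rewrite sumr_const Sk mulrn_eq0 -[k == _]negbK -lt0n k_gt0.
Qed.

Definition sumker (S : {set 'I_n}) : {vspace 'rV[F]_n} :=
  lker (linfun (mulmxr (\col_i (i \in S)%:R) : 'rV[F]_n -> 'rV[F]_1)).

Lemma mem_sumker S h : (h \in sumker S) = (\sum_(i in S) h 0 i == 0).
Proof.
rewrite memv_ker lfunE /=.
have E : (h *m \col_i (i \in S)%:R) 0 0 = \sum_(i in S) h 0 i.
  rewrite mxE [RHS]big_mkcond; apply: eq_bigr => i _.
  by rewrite mxE; case: ifP; rewrite ?mulr1 ?mulr0.
apply/eqP/eqP => [hS | hS]; first by rewrite -E hS mxE.
by apply/rowP => i; rewrite ord1 E hS mxE.
Qed.

Lemma dim_cap_lt (K L : {vspace 'rV[F]_n}) h : h \in K -> h \notin L ->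
  (\dim (K :&: L) < \dim K)%N.
Proof.
move=> Kh Lh; rewrite ltn_neqAle dimvS ?capvSl // andbT.
rewrite (dimv_leqif_eq (capvSl K L)).
by apply: contra Lh => /eqP KL; move: Kh; rewrite -KL memv_cap => /andP[].
Qed.

(** Greedy choice: as long as the space of common solutions in K is not 0, some
    set of the next size has a nonzero sum on it and lowers its dimension.
    For K the full space the conclusion is that the indicators of the sets span
    the dual space. *)
Lemma separating_sets (K : {vspace 'rV[F]_n}) (ds : seq nat) :
  all (fun d => 0 < d < n)%N ds -> (\dim K <= size ds)%N ->
  exists2 Ss : seq {set 'I_n}, [seq #|pred_of_set A| | A <- Ss] = ds &
    forall h, h \in K ->
      {in Ss, forall S : {set 'I_n}, \sum_(i in S) h 0 i = 0} -> h = 0.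
Proof.
elim: ds K => [|d ds IHds] K /=.
  rewrite leqn0 dimv_eq0 => _ /eqP->; exists [::] => // h.
  by rewrite memv0 => /eqP.
case/andP => dn dsn leK.
have [S Sd leK'] : exists2 S : {set 'I_n}, #|S| = d &
    (\dim (K :&: sumker S) <= size ds)%N.
  have [K0|K0] := eqVneq K 0%VS.
    have [S _ Sd] : exists2 S : {set 'I_n}, S \subset [set: 'I_n] & #|S| = d.
      by apply: exists_subset_card; rewrite cardsT card_ord; lia.
    by exists S => //; rewrite K0 cap0v dimv0.
  have [|S Sd hS] := @exists_sum_neq0 (vpick K) d _ dn; first by rewrite vpick0.
  exists S => //; rewrite -ltnS (leq_trans _ leK) //.
  by apply: (dim_cap_lt (memv_pick K)); rewrite mem_sumker.
have [Ss Ssds Ss0] := IHds _ dsn leK'.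
exists (S :: Ss) => [|h Kh hS]; first by rewrite /= Sd Ssds.
apply: Ss0 => [|S' Ss']; last by apply: hS; rewrite inE Ss' orbT.
by rewrite memv_cap Kh mem_sumker hS ?mem_head /=.
Qed.

End SeparatingSets.

(** * Projections onto spans of orthogonal vectors of equal norm *)

Section OrthogonalRows.

Variables (R : realType) (M : nat).
Implicit Types (x y : 'rV[R]_M) (S : {set 'I_M}) (W : {vspace 'rV[R]_M}).

Lemma orthproj_unique W x p :
  p \in W -> (forall w, w \in W -> dotv w (x - p) = 0) ->
  orthproj W x = p.
Proof.
move=> Wp p_orth; apply/eqP; rewrite eq_sym -subr_eq0 -dotvv_eq0.
have Wz : p - orthproj W x \in W by rewrite rpredB ?orthproj_mem.
have -> : dotv (p - orthproj W x) (p - orthproj W x) =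
  dotv (p - orthproj W x) ((x - orthproj W x) - (x - p)).
  by congr (dotv _ _); rewrite opprB [RHS]addrC addrA subrK.
by rewrite linearB /= orthproj_orth // p_orth // subrr.
Qed.

Variables (V : 'M[R]_M) (q : R).
Hypotheses (VVT : V *m V^T = q%:M) (q_neq0 : q != 0).

Definition rowspan S : {vspace 'rV[R]_M} := <<[seq row j V | j <- enum S]>>%VS.

Lemma dotv_row j x : dotv (row j V) x = (V *m x^T) j 0.
Proof. by rewrite /dotv mxE; apply: eq_bigr => i _; rewrite !mxE. Qed.

Lemma dotv_rows k j : dotv (row k V) (row j V) = q *+ (k == j).
Proof.
have /matrixP/(_ k j) := VVT; rewrite !mxE => <-.
by apply: eq_bigr => i _; rewrite !mxE.
Qed.

Lemma VTV : V^T *m V = q%:M.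
Proof.
have /mulmx1C : V *m (q^-1 *: V^T) = 1%:M.
  by rewrite -scalemxAr VVT scale_scalar_mx mulVf.
rewrite -scalemxAl => /(congr1 (GRing.scale q)).
by rewrite scalerA divff // scale1r scalemx1.
Qed.

(** The rows of V span the space and there are M of them, so they are free. *)
Lemma dim_rowspan S : \dim (rowspan S) = #|S|.
Proof.
pose X := [seq row j V | j <- enum S ++ enum (~: S)].
have sizeX : size X = M by rewrite size_map size_cat -!cardE cardsC card_ord.
have X_full : (fullv <= <<X>>)%VS.
  apply/subvP => x _.
  have -> : x = q^-1 *: \sum_j (x *m V^T) 0 j *: row j V.
    rewrite -mulmx_sum_row -mulmxA VTV mul_mx_scalar.
    by rewrite scalerA mulVf // scale1r.
  apply/rpredZ/rpred_sum => j _; apply/rpredZ/memv_span/map_f.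
  by rewrite mem_cat !mem_enum inE orbN.
have freeX : free X.
  have le_M : (M <= \dim <<X>>)%N.
    by rewrite (leq_trans _ (dimvS X_full)) // dimvf /dim /= mul1n.
  by rewrite /free eqn_leq dim_span sizeX.
have : free [seq row j V | j <- enum S].
  by move: freeX; rewrite /X map_cat => /catl_free.
by rewrite /free size_map -cardE => /eqP.
Qed.

Lemma dotv_orthproj_rowspan S x :
  dotv (orthproj (rowspan S) x) (orthproj (rowspan S) x) =
  q^-1 * \sum_(j in S) (V *m x^T) j 0 ^+ 2.
Proof.
pose p := q^-1 *: \sum_(j in S) (V *m x^T) j 0 *: row j V.
have Wp : p \in rowspan S.
  apply/rpredZ/rpred_sum => j Sj; apply/rpredZ/memv_span/map_f.
  by rewrite mem_enum.
have p_orth w : w \in rowspan S -> dotv w (x - p) = 0.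
  suff /subvP sub :
      (rowspan S <= lker (linfun (dotv (x - p) : 'rV[R]_M -> R^o)))%VS.
    by move/sub; rewrite memv_ker lfunE /= dotvC => /eqP.
  apply/span_subvP => _ /mapP[k + ->]; rewrite mem_enum => Sk.
  rewrite memv_ker lfunE /= dotvC linearB /= linearZ linear_sum /=.
  rewrite (bigD1 k) //=.
  rewrite [\sum_(_ in _ | _) _]big1 => [|j /andP[_ /negPf neq_jk]].
    rewrite addr0 linearZ /= dotv_rows eqxx dotv_row /GRing.scale /=.
    by rewrite mulrCA mulVf // mulr1 subrr.
  by rewrite linearZ /= dotv_rows eq_sym neq_jk scaler0.
rewrite (orthproj_unique Wp p_orth).
have -> : dotv p p = dotv p x.
  by apply/eqP; rewrite eq_sym -subr_eq0 -linearB /= p_orth.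
rewrite dotvC linearZ linear_sum /=; congr (_ * _); apply: eq_bigr => j _.
by rewrite linearZ /= dotvC dotv_row.
Qed.

Lemma dotvv_ge0 x : 0 <= dotv x x.
Proof. by apply: sumr_ge0 => i _; rewrite -expr2 sqr_ge0. Qed.

(** By [dotv_orthproj_rowspan] the hypothesis equates two sums of squares, and
    each difference of squares factors. *)
Lemma eq_enorm_orthproj_rowspan S x y :
  enorm (orthproj (rowspan S) x) = enorm (orthproj (rowspan S) y) ->
  \sum_(j in S) (V *m (x + y)^T) j 0 * (V *m (x - y)^T) j 0 = 0.
Proof.
move/eqP; rewrite /enorm eqr_sqrt ?dotvv_ge0 // !dotv_orthproj_rowspan.
move/eqP/(mulfI (invr_neq0 q_neq0))/eqP.
rewrite -subr_eq0 -sumrB => /eqP E; rewrite -[RHS]E.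
apply: eq_bigr => j _; rewrite linearD linearB /= mulmxDr mulmxBr !mxE; ring.
Qed.

(** V preserves inner products up to the factor q; so the orthogonality found
    in the first basis becomes one linear relation known in the second. *)
Lemma sum_coord_mul (u v : 'cV[R]_M) :
  \sum_j (V *m u) j 0 * (V *m v) j 0 = q * \sum_j u j 0 * v j 0.
Proof.
have dotE (a b : 'cV[R]_M) : \sum_j a j 0 * b j 0 = (a^T *m b) 0 0.
  by rewrite mxE; apply: eq_bigr => j _; rewrite mxE.
by rewrite !dotE trmx_mul -mulmxA (mulmxA V^T) VTV mul_scalar_mx -scalemxAr mxE.
Qed.

End OrthogonalRows.

(** * Phase retrieval with 2M - 1 subspaces *)

Theorem theorem2p5 (R : realType) (M : nat) (d : 'I_(2 * M - 1) -> nat) :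
  (0 < M)%N ->
  (forall n, (1 <= d n < M - 1)%N) ->
  exists W : 'I_(2 * M - 1) -> {vspace 'rV[R]_M},
    (forall n, \dim (W n) = d n) /\ phase_retrieval W.
Proof.
move=> M_gt0 d_bounds.
have [V [q VVT] Vgen] := exists_generic_orthogonal R M.
(* Otherwise V would be singular, as V V^T = 0 with M > 0. *)
have q_neq0 : q != 0.
  have /eqP q0 := Vgen 1%g setT; apply/negP => /eqP q_eq0; case: q0.
  have -> : mixmx 1%g setT V = V by apply/matrixP => i j; rewrite mxE inE perm1.
  apply/eqP; rewrite -sqrf_eq0 expr2 -{2}det_tr -det_mulmx VVT q_eq0 det_scalar.
  by rewrite expr0n gtn_eqF.
have oneT : 1%:M *m (1%:M : 'M[R]_M)^T = 1%:M by rewrite trmx1 mulmx1.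
pose ds := [seq d n | n <- enum 'I_(2 * M - 1)].
have sz_ds : size ds = (2 * M - 1)%N by rewrite size_map size_enum_ord.
have : all (fun k => 0 < k < M)%N ds.
  by apply/allP => _ /mapP[n _ ->]; have := d_bounds n; lia.
rewrite -(cat_take_drop M ds) all_cat => /andP[ds1 ds2].
have [|Ss1 Ss1d Ss1P] := separating_sets (K := fullv : {vspace 'rV[R]_M}) ds1.
  by rewrite dimvf /dim /= mul1n size_takel // sz_ds; lia.
have [|Ss2 Ss2d Ss2P] := separating_sets (K := sumker R [set: 'I_M]) ds2.
  (* The all-ones vector is outside the kernel, whose dimension is thus at
     most M - 1, the number of remaining subspaces. *)
  rewrite size_drop sz_ds.
  have /dim_cap_lt : (const_mx 1 : 'rV[R]_M) \in fullv by exact: memvf.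
  move/(_ (sumker R setT)); rewrite mem_sumker capfv dimvf /dim /= mul1n.
  rewrite (eq_bigr (fun=> 1)) => [|i _]; last by rewrite mxE.
  rewrite sumr_const cardsT card_ord pnatr_eq0 -lt0n => /(_ M_gt0); lia.
pose Ws := [seq rowspan 1%:M A | A <- Ss1] ++ [seq rowspan V A | A <- Ss2].
have dimWs : [seq \dim (U : {vspace 'rV[R]_M}) | U <- Ws] = ds.
  rewrite map_cat -!map_comp -[RHS](cat_take_drop M) -Ss1d -Ss2d.
  congr (_ ++ _); apply: eq_map => S /=.
    by rewrite (dim_rowspan oneT (oner_neq0 _)).
  by rewrite (dim_rowspan VVT q_neq0).
have sz_Ws : size Ws = (2 * M - 1)%N by rewrite -sz_ds -dimWs size_map.
exists (fun n => nth 0%VS Ws n); split=> [n|x y eq_xy].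
  rewrite -(nth_map 0%VS 0%N (fun U : {vspace 'rV[R]_M} => \dim U)) ?sz_Ws //.
  rewrite dimWs (nth_map n) ?size_enum_ord //.
  by rewrite nth_ord_enum.
have {}eq_xy U : U \in Ws -> enorm (orthproj U x) = enorm (orthproj U y).
  move=> WsU.
  have lt_U : (index U Ws < 2 * M - 1)%N by rewrite -sz_Ws index_mem.
  by have := eq_xy (Ordinal lt_U); rewrite /= nth_index.
pose u := (x + y)^T; pose v := (x - y)^T.
have std0 i : u i 0 * v i 0 = 0.
  have := Ss1P (\row_i (u i 0 * v i 0)) (memvf _).
  move=> /(_ _)/rowP/(_ i); rewrite !mxE; apply=> S SsS.
  apply: etrans (eq_enorm_orthproj_rowspan oneT (oner_neq0 _) (eq_xy _ _)).
    by apply: eq_bigr => j _; rewrite mxE !mul1mx.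
  by rewrite mem_cat (map_f (rowspan 1%:M)).
have V0 j : (V *m u) j 0 * (V *m v) j 0 = 0.
  have := Ss2P (\row_i ((V *m u) i 0 * (V *m v) i 0)).
  rewrite mem_sumker (eq_bigl xpredT) => [|i]; last by rewrite inE.
  rewrite (eq_bigr (fun j => (V *m u) j 0 * (V *m v) j 0)) => [|i _]; last first.
    by rewrite mxE.
  rewrite (sum_coord_mul VVT q_neq0) big1 ?mulr0 ?eqxx => [|i _]; last first.
    exact: std0.
  move=> /(_ isT _)/rowP/(_ j); rewrite !mxE; apply=> S SsS.
  apply: etrans (eq_enorm_orthproj_rowspan VVT q_neq0 (eq_xy _ _)).
    by apply: eq_bigr => i _; rewrite mxE.
  by rewrite mem_cat orbC (map_f (rowspan V)).
have [/(congr1 trmx)|/(congr1 trmx)] := disjoint_supp_eq0 Vgen std0 V0.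
  by rewrite trmxK trmx0 => /eqP; rewrite addr_eq0 => /eqP; right.
by rewrite trmxK trmx0 => /eqP; rewrite subr_eq0 => /eqP; left.
Qed.
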